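(* Let $G$ be a finite simple undirected connected graph on $n$ vertices with minimum degree $\delta$, and suppose that $G$ is not a dumbbell. Let $\mu_2$ and $\mu_n$ denote the second smallest and the largest eigenvalue of the Laplacian matrix of $G$, respectively, and let $b(G)$ denote the number of balloons in $G$. Let $r$ be a real number with $0 < r \le \min\{\frac{1}{3}, \frac{1}{\delta+1}\}$. (i) If $\delta \ge 2$ and $\mu_2 \ge (1 - r - r\delta)\mu_n$, then $b(G) \le \lceil rn \rceil$. (ii) If $\delta = 1$ and $\mu_2 \ge (1 - 3r)\mu_n$, then $b(G) \le \lceil rn \rceil$.
   Context: The Laplacian matrix of a graph $G$ is $L = D - A$, where $D$ is the diagonal matrix of vertex degrees and $A$ is the adjacency matrix. The eigenvalues of $L$ are listed with multiplicity in nondecreasing order $0=\mu_1 \le \mu_2 \le \cdots \le \mu_n$. A balloon in a graph $G$ is a maximal 2-edge-connected subgraph of $G$ that is incident to exactly one cut-edge of $G$ (i.e. it is joined to the rest of the graph by a single edge). Here a single vertex does not count as a 2-edge-connected graph, so every balloon has at least 3 vertices (in particular, a vertex of degree 1 is not a balloon). A balloon may contain cut-vertices. A dumbbell is a graph consisting of exactly two balloons joined by a single edge. *)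

(* Defs.v *)
From HB Require Import structures.
From mathcomp Require Import all_boot all_order all_algebra.
From mathcomp Require Import reals polyrcf.
Set Implicit Arguments. Unset Strict Implicit. Unset Printing Implicit Defensive.
Import Order.TTheory GRing.Theory Num.Theory.
Local Open Scope ring_scope.

Section Spectrum.
Variable R : realType.

(* [rootsR p] is strictly increasing and lists each root of [p] once; each root
   is repeated here according to its multiplicity. For a symmetric matrix this
   is the full spectrum, since its characteristic polynomial splits over R. *)
Definition eigenvalues n (A : 'M[R]_n) : seq R :=
  flatten [seq nseq (mup x (char_poly A)) x | x <- rootsR (char_poly A)].

(* The k-th smallest eigenvalue, counted from k = 1. *)
Definition eig n (A : 'M[R]_n) (k : nat) : R := nth 0 (eigenvalues A) k.-1.

End Spectrum.

(* A finite simple graph is a symmetric irreflexive [e : rel T], T finite. *)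
Section Graph.
Variables (T : finType) (e : rel T).

Definition deg (x : T) : nat := #|[set y | e x y]|.

(* In a nonempty simple graph all degrees are below #|T|, so the default value
   of the minimum is never attained. *)
Definition min_deg : nat := \big[minn/#|T|]_(x : T) deg x.

Definition degree_mx (R : realType) : 'M[R]_#|T| :=
  diag_mx (\row_i (deg (enum_val i))%:R).

Definition adjacency_mx (R : realType) : 'M[R]_#|T| :=
  \matrix_(i, j) (e (enum_val i) (enum_val j))%:R.

Definition laplacian (R : realType) : 'M[R]_#|T| :=
  degree_mx R - adjacency_mx R.

Definition edges : {set {set T}} :=
  [set A | [exists x, [exists y, e x y && (A == [set x; y])]]].

(* A pair (V, F): vertex set V, edge set F. *)
Definition graph : finType := ({set T} * {set {set T}})%type.

Definition whole : graph := ([set: T], edges).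

Definition subgraph (H K : graph) : bool :=
  (H.1 \subset K.1) && (H.2 \subset K.2).

Definition subgraph_of_G (H : graph) : bool :=
  subgraph H whole && [forall A in H.2, A \subset H.1].

Definition adj (F : {set {set T}}) : rel T := [rel x y | [set x; y] \in F].

Definition connected (H : graph) : bool :=
  (H.1 != set0) && [forall x in H.1, forall y in H.1, connect (adj H.2) x y].

Definition delete_edge (H : graph) (A : {set T}) : graph := (H.1, H.2 :\ A).

Definition two_edge_connected (H : graph) : bool :=
  [&& (1 < #|H.1|)%N, connected H
    & [forall A in H.2, connected (delete_edge H A)]].

Definition maximal_two_edge_connected (H : graph) : bool :=
  [&& subgraph_of_G H, two_edge_connected H
    & [forall K : graph,
        [&& subgraph_of_G K, two_edge_connected K & subgraph H K]
          ==> (K == H)]].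

(* Deleting A increases the number of connected components of G. *)
Definition cut_edge (A : {set T}) : bool :=
  (A \in edges) &&
  (n_comp (adj edges) [set: T] < n_comp (adj (edges :\ A)) [set: T])%N.

Definition incident (A : {set T}) (H : graph) : bool := A :&: H.1 != set0.

Definition balloon (H : graph) : bool :=
  maximal_two_edge_connected H &&
  (#|[set A | cut_edge A && incident A H]| == 1)%N.

Definition balloons : {set graph} := [set H | balloon H].

Definition dumbbell : Prop :=
  exists (H1 H2 : graph) (x y : T),
    [/\ H1 != H2, balloons = [set H1; H2], x \in H1.1 & y \in H2.1] /\
    whole = (H1.1 :|: H2.1, [set x; y] |: (H1.2 :|: H2.2)).

End Graph.

(* Main.v *)
Require Import Defs.
From mathcomp Require Import all_boot all_order all_algebra.
From mathcomp Require Import reals.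
From mathcomp Require Import polyrcf complex spectral ring lra.
Set Implicit Arguments. Unset Strict Implicit. Unset Printing Implicit Defensive.
Import Order.TTheory GRing.Theory Num.Theory.
Local Open Scope ring_scope.

(** Why the theorem holds. Let [s] be a lower bound for the number of vertices of
    a balloon, [b] the number of balloons, [X] the union of their vertex sets and
    [n = #|T|], [x = #|X|], [t = (b - 1) * s]. Suppose that [b] exceeds the
    ceiling of [r * n], so that [r * n <= b - 1] and [1 < b].

    Both extreme eigenvalues are compared with edge cuts. Putting the vector
    [n * 1_A - #|A|], which is orthogonal to the constants, in the Rayleigh
    quotient of the Laplacian gives
      [mu2 * #|A| * (n - #|A|) <= n * #|cut A| <= mun * #|A| * (n - #|A|)]
    for every vertex set [A] ([second_le_cut], [cut_le_max]).

    - The largest balloon has [k] vertices with [x <= b * k] and [k + t <= x], and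
      a single edge leaves it; the lower estimate bounds [mu2] by
      [n / (k * (n - k))], hence by [n * b / (x * (n - x + t))].
    - As the graph is not a dumbbell, the edge leaving a balloon ends outside [X]
      ([balloon_exit]), so at least [b] edges leave [X], and [X] is not the whole
      vertex set; the upper estimate bounds [mun] below by
      [n * b / (x * (n - x))].

    The hypothesis yields [(n - t) * mun <= n * mu2], and the three inequalities
    together give [(n - t) * (n - x + t) <= n * (n - x)], that is
    [t * (x - t) <= 0], which is absurd ([balloon_balance]).

    On the combinatorial side everything follows from one description: a maximal
    2-edge-connected subgraph is a connected component of the graph whose edges
    are the non-cut-edges ([maximal_is_component]). Balloons are therefore
    disjoint, every edge leaving one is a cut-edge, and no cut-edge joins two of
    its vertices. The size bound is [s = 3] always, because two vertices carry at
    most one edge, and [s = min_deg + 1], because a vertex of the balloon other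
    than the end of its cut-edge has all its neighbours in the balloon. *)

(** * Spectrum and Rayleigh quotients of a real symmetric matrix *)

Section RealSymmetricMatrices.
Local Open Scope sesquilinear_scope.
Local Open Scope complex_scope.

Lemma char_poly_unitary_conj (C : numClosedFieldType) n (P D : 'M[C]_n) :
  P \is unitarymx -> char_poly (P^t* *m D *m P) = char_poly D.
Proof.
move=> Pu; have PQ : P^t* *m P = 1%:M.
  by apply: mulmx1C; apply/unitarymxP.
have QP : \det (map_mx polyC (P^t*)) * \det (map_mx polyC P) = 1.
  by rewrite -det_mulmx -map_mxM PQ map_mx1 det1.
rewrite /char_poly -[RHS]mul1r -QP mulrAC -!det_mulmx; congr (\det _).
rewrite /char_poly_mx !map_mxM /= mulmxBr mulmxBl; congr (_ - _).
by rewrite mul_mx_scalar -scalemxAl -map_mxM PQ map_mx1 scalemx1.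
Qed.

(** Seen over [R[i]], [A] is Hermitian, so the spectral theorem for normal matrices
    over an algebraically closed field applies and its eigenvalues are real. The
    eigenvectors, the rows of [P], may stay complex: the estimates below involve
    only the squared moduli of coordinates. *)
Lemma symmetric_diagonalization (R : rcfType) n (A : 'M[R]_n) : A^T = A ->
  exists (P : 'M[R[i]]_n) (d : 'I_n -> R), P \is unitarymx /\
    map_mx (real_complex R) A
      = P^t* *m diag_mx (\row_i (real_complex R (d i))) *m P.
Proof.
move=> Asym; set B := map_mx _ A.
have Bh : B \is hermsymmx.
  apply: realsym_hermsym.
    by apply/is_hermitianmxP; rewrite expr0 scale1r map_mx_id // /B map_trmx Asym.
  by apply/mxOverP => i j; rewrite mxE complex_real.
have Breal := hermitian_spectral_diag_real Bh.
exists (spectralmx B), (fun i => complex.Re (spectral_diag B 0 i)).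
split; first exact: spectral_unitarymx.
rewrite -invmx_unitary ?spectral_unitarymx //.
have /hermitian_normalmx /orthomx_spectralP Beq := Bh.
rewrite [LHS]Beq; congr (_ *m diag_mx _ *m _).
by apply/rowP => i; rewrite mxE RRe_real //; exact: (mxOverP Breal).
Qed.

Lemma char_poly_diagonalized (R : rcfType) n (A : 'M[R]_n) (P : 'M[R[i]]_n) d :
    P \is unitarymx ->
    map_mx (real_complex R) A
      = P^t* *m diag_mx (\row_i (real_complex R (d i))) *m P ->
  char_poly A = \prod_(i < n) ('X - (d i)%:P).
Proof.
move=> Pu eqA; apply: (map_poly_inj (real_complex R)).
rewrite map_char_poly eqA char_poly_unitary_conj //.
rewrite char_poly_trig ?diag_mx_is_trig // rmorph_prod.
apply: eq_bigr => i _.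
by rewrite !mxE eqxx mulr1n rmorphB /= map_polyX map_polyC.
Qed.

(** Each root occurs in [eigenvalues] as often as its multiplicity, and the
    multiplicity of a root of a split polynomial counts its linear factors. *)
Lemma eigenvalues_diagonalized (R : realType) n (A : 'M[R]_n) (d : 'I_n -> R) :
  char_poly A = \prod_(i < n) ('X - (d i)%:P) ->
  perm_eq (eigenvalues A) [seq d i | i <- enum 'I_n].
Proof.
move=> charE.
have p0 : char_poly A != 0 by rewrite monic_neq0 ?char_poly_monic.
have mupE x : mup x (char_poly A) = count_mem x [seq d i | i <- enum 'I_n].
  by rewrite -mu_prod_XsubC big_map big_enum -charE.
have rootsE := roots_on_rootsR p0.
apply/allP => x _ /=; apply/eqP; rewrite -mupE /eigenvalues count_flatten -map_comp.
rewrite sumnE big_map.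
have [xr|xr] := boolP (x \in rootsR (char_poly A)).
  rewrite (bigD1_seq x) //=; last first.
    by apply: (sorted_uniq lt_trans ltxx); exact: sorted_roots.
  rewrite /= count_nseq /= eqxx mul1n big1 ?addn0 // => y /negPf yx.
  by rewrite count_nseq /= yx.
rewrite mupNroot; last first.
  have := rootsE x; rewrite in_itv /= => ->; exact: xr.
rewrite big_seq big1 // => y yr; rewrite /= count_nseq /=.
by case: eqP => // yx; rewrite -yx yr in xr.
Qed.

Lemma sorted_eigenvalues (R : realType) n (A : 'M[R]_n) :
  sorted <=%R (eigenvalues A).
Proof.
rewrite /eigenvalues; have : sorted <%R (rootsR (char_poly A)) by exact: sorted_roots.
elim: (rootsR _) => //= x s IHs xs.
rewrite sorted_pairwise ?pairwise_cat; last exact: le_trans.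
rewrite -!sorted_pairwise ?IHs ?(path_sorted xs) //=; try exact: le_trans.
rewrite andbT; apply/andP; split; last first.
  by case: (mup _ _) => //= m; elim: m => //= m ->; rewrite lexx.
apply/allrelP => y z /nseqP[-> _] /flattenP[_ /mapP[t ts ->] /nseqP[-> _]].
by move: xs; rewrite lt_path_sortedE => /andP[/allP/(_ _ ts)/ltW].
Qed.

Lemma size_eigenvalues_diagonalized (R : realType) n (A : 'M[R]_n) (d : 'I_n -> R) :
  perm_eq (eigenvalues A) [seq d i | i <- enum 'I_n] -> size (eigenvalues A) = n.
Proof. by move/perm_size; rewrite size_map size_enum_ord. Qed.

Lemma le_eig_max (R : realType) n (A : 'M[R]_n) (d : 'I_n -> R) :
  perm_eq (eigenvalues A) [seq d i | i <- enum 'I_n] ->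
  forall i, d i <= eig A n.
Proof.
move=> Ad i; have szA := size_eigenvalues_diagonalized Ad.
have : d i \in eigenvalues A by rewrite (perm_mem Ad) map_f ?mem_enum.
case/(nthP 0) => j; rewrite szA => jn <-.
have n1 : (n.-1 < n)%N by case: (n) jn.
by apply: (sorted_leq_nth le_trans lexx) (sorted_eigenvalues A) _ _ _ _ _;
  rewrite ?inE ?szA // -ltnS prednK // (leq_ltn_trans _ jn).
Qed.

(** The exceptional index is the one sorted into first position. *)
Lemma eig2_le_but_one (R : realType) n (A : 'M[R]_n) (d : 'I_n -> R) :
    perm_eq (eigenvalues A) [seq d i | i <- enum 'I_n] -> (1 < n)%N ->
  exists i0, forall i, i != i0 -> eig A 2 <= d i.
Proof.
move=> Ad n1; have szA := size_eigenvalues_diagonalized Ad.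
have [s /= s_perm eqs] := perm_iotaP 0 Ad.
have sz : size s = n by rewrite (perm_size s_perm) size_iota size_map size_enum_ord.
have nthE k : (k < n)%N ->
    nth 0 (eigenvalues A) k = nth 0 [seq d i | i <- enum 'I_n] (nth 0%N s k).
  by move=> kn; rewrite eqs (nth_map 0%N) ?sz.
have s0n : (nth 0%N s 0 < n)%N.
  have : nth 0%N s 0 \in s by rewrite mem_nth ?sz // ltnW.
  by rewrite (perm_mem s_perm) mem_iota size_map size_enum_ord.
exists (Ordinal s0n) => i ii0.
have i_in_s : val i \in s by rewrite (perm_mem s_perm) mem_iota size_map size_enum_ord /=.
have [k kn ki] := nthP 0%N i_in_s; rewrite sz in kn.
have -> : d i = nth 0 (eigenvalues A) k.
  by rewrite nthE // ki (nth_map i) ?size_enum_ord //= nth_ord_enum.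
apply: (sorted_leq_nth le_trans lexx) (sorted_eigenvalues A) _ _ _ _ _;
  rewrite ?inE ?szA // lt0n.
by apply: contra ii0 => /eqP k0; apply/eqP/val_inj; rewrite /= -ki k0.
Qed.

Section Diagonalized.
Variables (R : realType) (n : nat) (A : 'M[R]_n).
Variables (P : 'M[R[i]]_n) (d : 'I_n -> R).
Hypothesis Pu : P \is unitarymx.
Hypothesis eqA : map_mx (real_complex R) A
  = P^t* *m diag_mx (\row_i (real_complex R (d i))) *m P.

(** The rows of [P] form an orthonormal eigenbasis, so the adjoint of [P] gives
    the coordinates in it. *)
Definition eigencoord (v : 'rV[R]_n) : 'rV[R[i]]_n :=
  map_mx (real_complex R) v *m P^t*.

Lemma map_real_adjoint (v : 'rV[R]_n) :
  map_mx (real_complex R) v^T = (map_mx (real_complex R) v)^t*.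
Proof. by apply/matrixP => i j; rewrite !mxE; exact/esym/conjc_real. Qed.

Lemma eigencoord_dot (u v : 'rV[R]_n) :
  real_complex R ((u *m v^T) 0 0) =
  \sum_i eigencoord u 0 i * (eigencoord v 0 i)^*.
Proof.
have -> : real_complex R ((u *m v^T) 0 0)
    = (map_mx (real_complex R) (u *m v^T)) 0 0 by rewrite [RHS]mxE.
have /unitarymxP PP := Pu.
rewrite map_mxM map_real_adjoint.
transitivity ((eigencoord u *m (eigencoord v)^t*) 0 0); last first.
  by rewrite mxE; apply: eq_bigr => i _; rewrite !mxE.
rewrite /eigencoord trmx_mul map_mxM trmxCK -!mulmxA (mulmxA _ P).
by rewrite (mulmx1C PP) mul1mx.
Qed.

Lemma eigencoord_mul (v : 'rV[R]_n) i :
  eigencoord (v *m A) 0 i = real_complex R (d i) * eigencoord v 0 i.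
Proof.
have /unitarymxP PP := Pu.
rewrite /eigencoord map_mxM eqA -!mulmxA PP mulmx1 mulmxA.
by rewrite mul_mx_diag !mxE mulrC.
Qed.

Definition weight (v : 'rV[R]_n) i : R := Normc.normc (eigencoord v 0 i) ^+ 2.

Lemma weightE v i :
  real_complex R (weight v i) = eigencoord v 0 i * (eigencoord v 0 i)^*.
Proof. by rewrite -sqr_normc rmorphXn. Qed.

Lemma norm_weight v : (v *m v^T) 0 0 = \sum_i weight v i.
Proof.
apply: complexI; rewrite eigencoord_dot rmorph_sum.
by apply: eq_bigr => i _; rewrite [RHS]weightE.
Qed.

Lemma form_weight v : (v *m A *m v^T) 0 0 = \sum_i d i * weight v i.
Proof.
apply: complexI; rewrite eigencoord_dot rmorph_sum.
by apply: eq_bigr => i _; rewrite eigencoord_mul -mulrA -weightE [RHS]rmorphM.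
Qed.

Lemma weight_ge0 v i : 0 <= weight v i.
Proof. exact: sqr_ge0. Qed.

End Diagonalized.

Lemma rayleigh_le_max (R : realType) n (A : 'M[R]_n) (v : 'rV[R]_n) : A^T = A ->
  (v *m A *m v^T) 0 0 <= eig A n * (v *m v^T) 0 0.
Proof.
move=> /symmetric_diagonalization[P [d [Pu eqA]]].
have Ad := eigenvalues_diagonalized (char_poly_diagonalized Pu eqA).
rewrite (form_weight Pu eqA) (norm_weight Pu) mulr_sumr.
by apply: ler_sum => i _; rewrite ler_wpM2r ?weight_ge0 // (le_eig_max Ad).
Qed.

(** A minimal form of the Courant-Fischer principle. If [eig A 2 <= 0] the claim is
    the nonnegativity of the form at [v]. Otherwise all eigenvalues but one are
    positive, so [u], which [A] kills, is a multiple of the remaining eigenvector;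
    [v] has no component along it, and all the others have eigenvalue at least
    [eig A 2]. *)
Lemma rayleigh_ge_second (R : realType) n (A : 'M[R]_n) (u v : 'rV[R]_n) :
    A^T = A -> 0 <= (v *m A *m v^T) 0 0 ->
    u != 0 -> u *m A = 0 -> u *m v^T = 0 ->
  eig A 2 * (v *m v^T) 0 0 <= (v *m A *m v^T) 0 0.
Proof.
move=> /symmetric_diagonalization[P [d [Pu eqA]]] vAv u0 uA uv.
have Ad := eigenvalues_diagonalized (char_poly_diagonalized Pu eqA).
have [mu2_le0|mu2_gt0] := leP (eig A 2) 0.
  apply: le_trans vAv; rewrite mulr_le0_ge0 // (norm_weight Pu).
  by apply: sumr_ge0 => i _; exact: weight_ge0.
have n1 : (1 < n)%N.
  rewrite ltnNge; apply: contraTN mu2_gt0 => n1.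
  by rewrite /eig nth_default ?ltxx // (size_eigenvalues_diagonalized Ad).
have [i0 di0] := eig2_le_but_one Ad n1.
(* [u] is concentrated on the coordinate [i0], and there it does not vanish. *)
have ucoord i : i != i0 -> eigencoord P u 0 i = 0.
  move=> ii0; have := eigencoord_mul Pu eqA u i.
  rewrite uA /eigencoord map_mx0 mul0mx mxE => /esym/eqP.
  rewrite mulf_eq0 => /orP[/eqP/complexI di|/eqP//].
  by have := lt_le_trans mu2_gt0 (di0 i ii0); rewrite di ltxx.
have ui0 : eigencoord P u 0 i0 != 0.
  apply: contraNneq u0 => ui0; apply/eqP.
  have : eigencoord P u = 0.
    apply/rowP => i; rewrite [RHS]mxE.
    by have [->//|] := eqVneq i i0; exact: ucoord.
  move/(congr1 (mulmx^~ P)); rewrite /eigencoord -mulmxA mul0mx.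
  have /unitarymxP/mulmx1C -> := Pu; rewrite mulmx1 => /rowP uC0.
  by apply/rowP => i; have := uC0 i; rewrite !mxE => /complexI.
have vi0 : weight P v i0 = 0.
  have := eigencoord_dot Pu u v; rewrite uv mxE (bigD1 i0) //= big1 => [|i ii0].
    rewrite addr0 => /esym/eqP; rewrite mulf_eq0 (negPf ui0) conjC_eq0 /= => /eqP v0.
    by rewrite /weight v0 Normc.normc0 expr0n.
  by rewrite ucoord ?mul0r.
rewrite (form_weight Pu eqA) (norm_weight Pu) mulr_sumr.
apply: ler_sum => i _; have [->|ii0] := eqVneq i i0; first by rewrite vi0 !mulr0.
by rewrite ler_wpM2r ?weight_ge0 // di0.
Qed.

End RealSymmetricMatrices.

(** * The Laplacian and edge cuts *)

Section LaplacianCut.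
Variables (R : realType) (T : finType) (e : rel T).
Hypothesis e_sym : symmetric e.
Implicit Types (f g : T -> R) (X : {set T}).

Definition row_fun f : 'rV[R]_#|T| := \row_i f (enum_val i).

(** An edge leaving [X] is recorded as the ordered pair (inner end, outer end), so
    each such edge is counted once. *)
Definition cut X : {set T * T} :=
  [set p | [&& p.1 \in X, p.2 \notin X & e p.1 p.2]].

Lemma row_fun_dot f g : (row_fun f *m (row_fun g)^T) 0 0 = \sum_x f x * g x.
Proof.
rewrite mxE (big_enum_val (fun x => f x * g x)).
by apply: eq_bigr => i _; rewrite !mxE.
Qed.

Lemma laplacian_sym : (laplacian e R)^T = laplacian e R.
Proof.
rewrite /laplacian linearB /= tr_diag_mx; congr (_ - _).
by apply/matrixP => i j; rewrite !mxE e_sym.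
Qed.

Lemma laplacian_row_fun f :
  row_fun f *m laplacian e R =
  row_fun (fun x => \sum_y (e x y)%:R * (f x - f y)).
Proof.
apply/rowP => j; rewrite mulmxBr mul_mx_diag !mxE.
set x := enum_val j.
under [RHS]eq_bigr => y _ do rewrite mulrBr.
rewrite sumrB; congr (_ - _).
  rewrite -mulr_suml mulrC; congr (_ * _).
  rewrite /deg -sum1_card natr_sum big_mkcond /=.
  by apply: eq_bigr => y _; rewrite inE; case: (e x y).
rewrite (big_enum_val (fun y => (e x y)%:R * f y)).
by apply: eq_bigr => i _; rewrite !mxE e_sym mulrC.
Qed.

(** The indicator of [X], scaled by [#|T|] and shifted to have sum zero: this makes
    it orthogonal to the constants, the kernel vectors of the Laplacian. *)
Definition centered X x : R := #|T|%:R * (x \in X)%:R - #|X|%:R.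

Lemma sum_indicator X : \sum_x ((x \in X)%:R : R) = #|X|%:R.
Proof.
rewrite -sum1_card natr_sum [RHS]big_mkcond /=.
by apply: eq_bigr => x _; case: (x \in X).
Qed.

Lemma sum_centered X : \sum_x centered X x = 0.
Proof.
rewrite sumrB -mulr_sumr sum_indicator sumr_const.
by rewrite mulr_natl mulrnAC -mulr_natl mulr_natr -mulrnA mulnC subrr.
Qed.

Lemma sum_sqr_centered X :
  \sum_x centered X x * centered X x = #|T|%:R * (#|X|%:R * (#|T|%:R - #|X|%:R)).
Proof.
transitivity (\sum_x (#|T|%:R * (#|T|%:R - #|X|%:R) * (x \in X)%:R
                     - #|X|%:R * centered X x)).
  apply: eq_bigr => x _; rewrite /centered; case: (x \in X) => /=; ring.
by rewrite sumrB -!mulr_sumr sum_indicator sum_centered; ring.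
Qed.

(** The form at [f] is the sum of [f x * (f x - f y)] over the ordered edges. For
    [f = centered X] the differences are [#|T|] times those of the indicator, and
    the constant shift contributes an antisymmetric sum, which vanishes. *)
Lemma form_centered X :
  (row_fun (centered X) *m laplacian e R *m (row_fun (centered X))^T) 0 0
  = #|T|%:R ^+ 2 * #|cut X|%:R.
Proof.
rewrite laplacian_row_fun row_fun_dot.
pose a x y : R := (e x y)%:R * ((x \in X)%:R - (y \in X)%:R).
have a0 : \sum_x \sum_y a x y = 0.
  have : \sum_x \sum_y a x y = - \sum_x \sum_y a x y.
    rewrite [LHS]exchange_big -sumrN; apply: eq_bigr => x _.
    rewrite -sumrN; apply: eq_bigr => y _.
    by rewrite /a e_sym -mulrN opprB.
  by move/eqP; rewrite -subr_eq0 opprK -mulr2n mulrn_eq0 => /eqP.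
have cutE : \sum_x \sum_y (x \in X)%:R * a x y = #|cut X|%:R.
  rewrite pair_bigA -sum1_card natr_sum [RHS]big_mkcond /=.
  apply: eq_bigr => -[x y] _; rewrite inE /a /=.
  by case: (x \in X); case: (y \in X); case: (e x y);
    rewrite /= ?subrr ?subr0 ?mulr0 ?mul0r ?mul1r ?mulr0 ?mulr1.
transitivity (#|T|%:R ^+ 2 * (\sum_x \sum_y (x \in X)%:R * a x y)
              - #|T|%:R * #|X|%:R * (\sum_x \sum_y a x y)).
  rewrite !mulr_sumr -sumrB; apply: eq_bigr => x _.
  rewrite mulr_suml !mulr_sumr -sumrB; apply: eq_bigr => y _.
  by rewrite /a /centered; ring.
by rewrite a0 cutE mulr0 subr0.
Qed.

Lemma card_no_vertex X : #|T| = 0%N -> #|X| = 0%N /\ #|cut X| = 0%N.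
Proof.
move=> T0; have X0 : #|X| = 0%N.
  by apply/eqP; rewrite -leqn0 -T0 max_card.
split=> //; apply/eqP; rewrite cards_eq0; apply/eqP/setP => -[x y].
by have := card0_eq X0 x; rewrite !inE /= => ->.
Qed.

Lemma cut_le_max X :
  #|T|%:R * #|cut X|%:R
    <= eig (laplacian e R) #|T| * (#|X|%:R * (#|T|%:R - #|X|%:R)).
Proof.
have [T0|T0] := posnP #|T|.
  by have [-> ->] := card_no_vertex X T0; rewrite mul0r !mulr0.
have := rayleigh_le_max (row_fun (centered X)) laplacian_sym.
rewrite form_centered row_fun_dot sum_sqr_centered.
by rewrite mulrCA expr2 -mulrA ler_pM2l ?ltr0n.
Qed.

Lemma second_le_cut X :
  eig (laplacian e R) 2 * (#|X|%:R * (#|T|%:R - #|X|%:R))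
    <= #|T|%:R * #|cut X|%:R.
Proof.
have [T0|T0] := posnP #|T|.
  by have [-> ->] := card_no_vertex X T0; rewrite mul0r !mulr0.
have one0 : row_fun (fun=> 1) != 0.
  apply/eqP => /rowP/(_ (Ordinal T0)); rewrite !mxE; exact/eqP/oner_neq0.
have := @rayleigh_ge_second _ _ _ (row_fun (fun=> 1)) (row_fun (centered X)) laplacian_sym.
rewrite form_centered row_fun_dot sum_sqr_centered.
rewrite mulrCA expr2 -mulrA ler_pM2l ?ltr0n //; apply => //.
- by rewrite !mulr_ge0 ?ler0n.
- rewrite laplacian_row_fun; apply/rowP => i; rewrite !mxE.
  by rewrite big1 // => y _; rewrite subrr mulr0.
- apply/matrixP => i j; rewrite !ord1 row_fun_dot mxE -mulr_sumr.
  by rewrite sum_centered mulr0.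
Qed.

End LaplacianCut.

(** * Connectivity and bridges *)

Lemma connect_morph (T U : finType) (e1 : rel T) (e2 : rel U) (f : T -> U) :
    (forall x y, e1 x y -> connect e2 (f x) (f y)) ->
  forall x y, connect e1 x y -> connect e2 (f x) (f y).
Proof.
move=> f12 x _ /connectP[p xp ->]; elim: p x xp => //= z p IHp x /andP[xz zp].
exact: connect_trans (f12 _ _ xz) (IHp _ zp).
Qed.

Lemma connect_inside (T : finType) (e1 e2 : rel T) (S : {pred T}) :
    (forall x y, x \in S -> e1 x y -> (y \in S) && e2 x y) ->
  forall x y, x \in S -> connect e1 x y -> connect e2 x y.
Proof.
move=> e12 x _ xS /connectP[p xp ->]; elim: p x xS xp => //= z p IHp x xS.
move=> /andP[/(e12 _ _ xS)/andP[zS xz] zp].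
exact: connect_trans (connect1 xz) (IHp _ zS zp).
Qed.

Section EdgeSets.
Variable T : finType.
Implicit Types (F : {set {set T}}) (A B : {set T}).

Lemma adj_sym F : symmetric (adj F).
Proof. by move=> x y; rewrite /adj /= setUC. Qed.

Lemma connect_adj_sym F : connect_sym (adj F).
Proof. exact/sym_connect_sym/adj_sym. Qed.

Lemma connect_adj_sub F F' : F \subset F' ->
  forall x y, connect (adj F) x y -> connect (adj F') x y.
Proof.
by move=> /subsetP sFF'; apply: connect_sub => x y xy; apply/connect1/sFF'.
Qed.

Lemma set2_eq_cross (S : {set T}) x y x' y' : x \in S -> x' \in S ->
  y \notin S -> y' \notin S -> [set x; y] = [set x'; y'] -> (x, y) = (x', y').
Proof.
move=> xS x'S yS y'S eqA.
have : x \in [set x'; y'] by rewrite -eqA set21.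
have : y \in [set x'; y'] by rewrite -eqA set22.
rewrite !inE => /orP[/eqP yE|/eqP ->]; first by rewrite yE x'S in yS.
by move=> /orP[/eqP ->//|/eqP xE]; rewrite -xE xS in y'S.
Qed.

(** Every walk can bypass the edge through the path joining its ends. *)
Lemma connect_redundant_edge F a b :
  connect (adj (F :\ [set a; b])) a b ->
  connect (adj (F :\ [set a; b])) =2 connect (adj F).
Proof.
move=> ab x y; apply/idP/idP; first exact/connect_adj_sub/subsetDl.
apply: connect_sub => {x y} x y xy.
have [xyE|xyN] := eqVneq [set x; y] [set a; b]; last first.
  by apply: connect1; rewrite /adj /= !inE xyN.
have : x \in [set a; b] by rewrite -xyE set21.
have : y \in [set a; b] by rewrite -xyE set22.
by rewrite !inE => /orP[] /eqP -> /orP[] /eqP -> //; rewrite connect_adj_sym.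
Qed.

(** Removing a bridge [B] of [F] from a smaller edge set [F'] keeps [a] and [b]
    connected in [F'] if they lie on the same side [S] of the bridge. Retract the
    vertices onto [S] by sending the other side to the end [p] of [B] in [S]: the
    edges inside [S] are kept, and all the others, [B] included, collapse to [p].
    The retraction maps a walk from [a] to [b] in [F'] to one that avoids [B]. *)
Lemma connect_remove_bridge F F' a b c d (B := [set c; d]) :
    F' \subset F -> ~~ connect (adj (F :\ B)) c d ->
    connect (adj (F :\ B)) a b -> connect (adj F') a b ->
  connect (adj (F' :\ B)) a b.
Proof.
move=> /subsetP sF'F Ncd ab ab'.
pose S := connect (adj (F :\ B)) a.
(* At most one end of the bridge lies in [S]; if none does, [p] is arbitrary. *)
pose p := if S c then c else d.
pose f x := if S x then x else p.
have Sab : S a by exact: connect0.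
have -> : a = f a by rewrite /f Sab.
have -> : b = f b by rewrite /f [S b]ab.
apply: connect_morph ab' => x y xy.
have [xyE|xyN] := eqVneq [set x; y] B; last first.
  have xyF : adj (F :\ B) x y by rewrite /adj /= !inE xyN sF'F.
  have SE : S x = S y.
    exact: (same_connect1r (@connect_adj_sym _)).
  rewrite /f -SE; case: (S x) => //.
  by apply: connect1; rewrite /adj /= !inE xyN.
have fB z : z \in B -> f z = p.
  rewrite !inE /f /p => /orP[]/eqP->; first by case: (S c).
  case Sd: (S d); case Sc: (S c) => //.
  by case/negP: Ncd; apply: connect_trans Sd; rewrite connect_adj_sym.
by rewrite !fB // -xyE ?set21 ?set22.
Qed.

End EdgeSets.

(** * Balloons as components of the graph of non-cut-edges *)

Section Balloons.
Variables (T : finType) (e : rel T).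
Hypothesis e_sym : symmetric e.
Hypothesis e_irr : irreflexive e.
Hypothesis e_conn : connected (whole e).

Lemma edges_pair x y : ([set x; y] \in edges e) = e x y.
Proof.
rewrite inE; apply/existsP/idP => [[a /existsP[b /andP[ab /eqP xyE]]]|xy].
  have : x \in [set a; b] by rewrite -xyE set21.
  have : y \in [set a; b] by rewrite -xyE set22.
  have : a \in [set x; y] by rewrite xyE set21.
  have : b \in [set x; y] by rewrite xyE set22.
  rewrite !inE => bxy axy; case/orP=> /eqP yE; case/orP=> /eqP xE; subst x y => //.
  - by move: bxy; rewrite orbb => /eqP ba; rewrite ba in ab *.
  - by rewrite e_sym.
  - by move: axy; rewrite orbb => /eqP ba; rewrite ba in ab *.
by exists x; apply/existsP; exists y; rewrite xy eqxx.
Qed.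

Lemma edgesP A : reflect (exists x y, e x y /\ A = [set x; y]) (A \in edges e).
Proof.
apply: (iffP idP) => [|[x [y [xy ->]]]]; last by rewrite edges_pair.
by rewrite inE => /existsP[x /existsP[y /andP[xy /eqP ->]]]; exists x, y.
Qed.

Lemma connect_edges x y : connect (adj (edges e)) x y.
Proof.
case/andP: e_conn => _ /forall_inP/(_ x (in_setT _))/forall_inP; apply.
by rewrite in_setT.
Qed.

(** A connected graph has one component, and deleting an edge creates another one
    exactly when it separates the ends of that edge. *)
Lemma cut_edgeE x y (A := [set x; y]) : e x y ->
  cut_edge e A = ~~ connect (adj (edges e :\ A)) x y.
Proof.
move=> xy; rewrite /cut_edge edges_pair xy /=.
have [/connect_redundant_edge con|Ncon] := boolP (connect _ x y).
  by rewrite (eq_n_comp con) ltnn.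
have -> : n_comp (adj (edges e)) [set: T] = 1%N.
  rewrite -(n_comp_connect (@connect_adj_sym _ (edges e)) x).
  apply: eq_n_comp_r => z; rewrite inE; apply/esym; exact: connect_edges.
set r := fingraph.root (adj (edges e :\ A)).
apply/card_gt1P; exists (r x), (r y); split.
- by rewrite !inE /= andbT roots_root //; exact: connect_adj_sym.
- by rewrite !inE /= andbT roots_root //; exact: connect_adj_sym.
by rewrite root_connect //; exact: connect_adj_sym.
Qed.

Definition nonbridges : {set {set T}} := [set A in edges e | ~~ cut_edge e A].

(** A non-cut-edge closes up a path in the rest of the graph. That path may use
    cut-edges, but both its ends lie on the same side of each of them, so that the
    cut-edges can be removed one after the other. *)
Lemma nonbridge_on_cycle x y (A := [set x; y]) : A \in nonbridges ->
  connect (adj (nonbridges :\ A)) x y.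
Proof.
rewrite inE edges_pair => /andP[xy Acut].
pose rest (D : seq {set T}) := [set B in edges e :\ A | B \notin D].
suff con (D : seq {set T}) : all (cut_edge e) D -> connect (adj (rest D)) x y.
  apply: connect_adj_sub (con (enum (cut_edge e)) _); last first.
    by apply/allP => B; rewrite mem_enum.
  by apply/subsetP => B; rewrite !inE mem_enum => /andP[/andP[-> ->]].
elim: D => [|B D IHD] /=.
  move=> _; move: Acut; rewrite cut_edgeE // negbK; apply: connect_adj_sub.
  by apply/subsetP => B; rewrite !inE andbT.
move=> /andP[Bcut /IHD con].
have /edgesP[c [d [cd BE]]] : B \in edges e by case/andP: Bcut.
have BA : B != A by apply: contraNneq Acut => <-.
have := @connect_remove_bridge T (edges e) (rest D) x y c d.
rewrite -BE => /(_ _ _ _ con)/(connect_adj_sub _) -> //.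
- by apply/subsetP => C; rewrite !inE negb_or => /andP[-> /andP[/andP[-> ->] ->]].
- by apply/subsetP => C; rewrite !inE => /andP[/andP[]].
- by move: Bcut; rewrite BE cut_edgeE.
by apply: connect1; rewrite /adj /= in_setD1 edges_pair xy eq_sym BA.
Qed.

Definition component u : {set T} := [set x | connect (adj nonbridges) u x].

Definition component_graph u : graph T :=
  (component u, [set A in nonbridges | A \subset component u]).

Lemma component_closed u (F : {set {set T}}) x y : F \subset nonbridges -> x \in component u ->
  adj F x y -> (y \in component u) && ([set x; y] \subset component u).
Proof.
move=> /subsetP sF; rewrite inE => ux xy; have xyN : adj nonbridges x y by exact: sF.
have uy : connect (adj nonbridges) u y := connect_trans ux (connect1 xyN).
by rewrite subUset !sub1set !inE ux uy.
Qed.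

Lemma component_connected u : connected (component_graph u).
Proof.
apply/andP; split; first by apply/set0Pn; exists u; rewrite inE connect0.
apply/forall_inP => x xu; apply/forall_inP => y yu.
apply: (@connect_inside _ (adj nonbridges) _ (mem (component u))) => //.
  move=> a b au ab; have /andP[-> sab] := component_closed (subxx _) au ab.
  by rewrite /adj /= inE sab andbT; exact: ab.
move: xu yu; rewrite !inE => ux; apply: connect_trans.
by rewrite connect_adj_sym.
Qed.

Lemma component_two_edge_connected u : (1 < #|component u|)%N ->
  two_edge_connected (component_graph u).
Proof.
move=> gt1; apply/and3P; split; rewrite ?component_connected //.
apply/forall_inP => A; rewrite inE => /andP[AN Asub].
have /edgesP[a [b [ab AE]]] : A \in edges e by move: AN; rewrite inE => /andP[].
have au : a \in component u by rewrite (subsetP Asub) // AE set21.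
have conab : connect (adj ((component_graph u).2 :\ A)) a b.
  apply: (@connect_inside _ (adj (nonbridges :\ A)) _ (mem (component u))) => //.
    move=> x y xu xy; have /andP[-> sxy] := component_closed (subsetDl _ _) xu xy.
    by move: xy; rewrite /adj /= !inE sxy => /andP[-> ->].
  by rewrite AE; apply: nonbridge_on_cycle; rewrite -AE.
have /andP[u0 /forall_inP con] := component_connected u.
apply/andP; split=> //; apply/forall_inP => x xu; apply/forall_inP => y yu.
rewrite /delete_edge /= AE in conab *.
by rewrite connect_redundant_edge //; move/forall_inP: (con x xu); apply.
Qed.

(** An edge whose deletion leaves a connected subgraph containing its ends is not a
    cut-edge of the whole graph. *)
Lemma two_edge_connected_nonbridges H : subgraph_of_G e H ->
  two_edge_connected H -> H.2 \subset nonbridges.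
Proof.
case/andP=> /andP[_ /subsetP sHE] /forall_inP sH /and3P[_ _ /forall_inP con].
apply/subsetP => A AH; have AE := sHE _ AH; rewrite inE AE /=.
have /edgesP[a [b [ab eqA]]] := AE; rewrite eqA cut_edgeE // negbK -eqA.
have aH : a \in H.1 by rewrite (subsetP (sH _ AH)) // eqA set21.
have bH : b \in H.1 by rewrite (subsetP (sH _ AH)) // eqA set22.
have /andP[_ /forall_inP/(_ a aH)/forall_inP/(_ b bH)] := con _ AH.
by apply: connect_adj_sub; apply/setSD/subsetP.
Qed.

(** The subgraph consists of non-cut-edges and is connected, hence lies in the
    component of [u]; that component is 2-edge-connected, so maximality forces
    equality. *)
Lemma maximal_is_component H u : maximal_two_edge_connected e H -> u \in H.1 ->
  H = component_graph u.
Proof.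
case/and3P=> HG H2 /forallP/(_ (component_graph u))/implyP Hmax uH.
have sN := two_edge_connected_nonbridges HG H2.
have sH : subgraph H (component_graph u).
  have s1 : H.1 \subset component u.
    apply/subsetP => x xH; rewrite inE; apply: connect_adj_sub sN _ _ _.
    case/and3P: H2 => _ /andP[_ /forall_inP/(_ u uH)/forall_inP/(_ x xH)] //.
  rewrite /subgraph s1; apply/subsetP => A AH; rewrite inE (subsetP sN) //=.
  by apply: subset_trans s1; case/andP: HG => _ /forall_inP; apply.
apply/esym/eqP/Hmax/and3P; split=> //.
  rewrite /subgraph_of_G /subgraph subsetT /=; apply/andP; split.
    by apply/subsetP => A; rewrite !inE => /andP[/andP[]].
  by apply/forall_inP => A; rewrite inE => /andP[].
apply: component_two_edge_connected; case/and3P: H2 => H1 _ _.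
by apply: leq_trans H1 (subset_leq_card _); case/andP: sH.
Qed.

Lemma edge_out_of_maximal H x y : maximal_two_edge_connected e H ->
  x \in H.1 -> y \notin H.1 -> e x y -> cut_edge e [set x; y].
Proof.
move=> Hmax xH + xy; rewrite (maximal_is_component Hmax xH) /= inE.
apply: contraNT => Ncut; apply: connect1.
by rewrite /adj /= inE edges_pair xy.
Qed.

(** The ends of a cut-edge lie in different components of the graph of
    non-cut-edges. *)
Lemma edge_inside_maximal H x y : maximal_two_edge_connected e H ->
  x \in H.1 -> y \in H.1 -> e x y -> [set x; y] \in H.2.
Proof.
move=> Hmax xH yH xy; move: yH; rewrite (maximal_is_component Hmax xH) /= inE => con.
rewrite in_set subUset !sub1set [x \in _]in_set [y \in _]in_set connect0 con.
rewrite in_set edges_pair xy !andbT; apply/negP => cut.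
move: (cut); rewrite cut_edgeE // => /negP[].
apply: connect_adj_sub con; apply/subsetP => B; rewrite !inE => /andP[-> Bcut].
by rewrite andbT; apply: contraNneq Bcut => ->.
Qed.

(** The edges leaving a balloon are exactly the cut-edges incident with it. *)
Lemma balloon_cut H : balloon e H -> #|cut e H.1| = 1%N.
Proof.
case/andP=> Hmax /cards1P[A HA].
have := set11 A; rewrite -HA inE => /andP[cutA /set0Pn[x /setIP[xA xH]]].
have [y eA xy] : exists2 y, A = [set x; y] & e x y.
  have /edgesP[a [b [ab eA]]] : A \in edges e by case/andP: cutA.
  move: xA; rewrite eA !inE => /orP[]/eqP ->; first by exists b.
  by exists a; rewrite // 1?setUC 1?e_sym.
have yH : y \notin H.1.
  apply: contraTN cutA => yH; have := edge_inside_maximal Hmax xH yH xy.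
  rewrite -eA; have /subsetP sN : H.2 \subset nonbridges.
    by apply: two_edge_connected_nonbridges; case/and3P: Hmax.
  by move/sN; rewrite inE => /andP[].
apply/eqP/cards1P; exists (x, y); apply/setP => -[x' y']; rewrite !inE /=.
apply/idP/idP => [/and3P[x'H y'H xy']|/eqP[-> ->]]; last by rewrite xH yH.
apply/eqP; apply: (set2_eq_cross x'H xH y'H yH); rewrite -eA.
apply/set1P; rewrite -HA inE (edge_out_of_maximal Hmax x'H y'H xy') /=.
by apply/set0Pn; exists x'; rewrite !inE eqxx x'H.
Qed.

Lemma balloons_disjoint H H' : balloon e H -> balloon e H' ->
  H != H' -> [disjoint H.1 & H'.1].
Proof.
move=> /andP[Hmax _] /andP[H'max _]; apply: contraNT => /pred0Pn[u /= /andP[uH uH']].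
by rewrite (maximal_is_component Hmax uH) -(maximal_is_component H'max uH').
Qed.

Lemma min_deg_le z : (min_deg e <= deg e z)%N.
Proof.
rewrite /min_deg; have := mem_index_enum z.
elim: (index_enum T) => //= a s IHs; rewrite inE big_cons geq_min.
by case/orP=> [/eqP->|/IHs->]; rewrite ?leqnn ?orbT.
Qed.

(** Only one vertex [x] of the balloon has a neighbour outside it. Any other vertex
    [z] of the balloon has its whole closed neighbourhood there. *)
Lemma balloon_gt_min_deg H : balloon e H -> (min_deg e < #|H.1|)%N.
Proof.
move=> Hb; have /eqP/cards1P[[x y] cutE] := balloon_cut Hb.
have gt1 : (1 < #|H.1|)%N by case/andP: Hb => /and3P[_ /and3P[]].
have [z zH zx] : exists2 z, z \in H.1 & z != x.
  case/card_gt1P: gt1 => a [b [aH bH ab]].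
  have [ax|] := eqVneq a x; last by exists a.
  by exists b; rewrite // -ax eq_sym.
apply: (@leq_ltn_trans (deg e z)).
  exact: min_deg_le.
rewrite (cardsD1 z) zH ltnS; apply/subset_leq_card/subsetP => w.
rewrite inE => zw; rewrite !inE; apply/andP; split.
  by apply: contraTneq zw => ->; rewrite e_irr.
apply: contraNT zx => wH; have : (z, w) \in cut e H.1 by rewrite inE /= zH wH.
by rewrite cutE inE => /eqP[->].
Qed.

(** On two vertices the only possible edge is the whole vertex set, and deleting it
    disconnects them. *)
Lemma two_edge_connected_gt2 H : subgraph_of_G e H -> two_edge_connected H ->
  (2 < #|H.1|)%N.
Proof.
case/andP=> /andP[_ /subsetP sHE] /forall_inP sH /and3P[gt1 Hcon /forall_inP con].
rewrite ltn_neqAle gt1 andbT; apply/eqP => /esym H2.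
have edgeE A : A \in H.2 -> A = H.1.
  move=> AH; apply/eqP; rewrite eqEcard sH //= H2.
  have /edgesP[a [b [ab ->]]] := sHE _ AH.
  by rewrite cards2; case: eqP ab => // ->; rewrite e_irr.
have noedge : ~~ connected (H.1, set0).
  have /card_gt1P[a [b [aH bH ab]]] := gt1.
  apply/negP => /andP[_ /forall_inP/(_ a aH)/forall_inP/(_ b bH)].
  case/connectP=> [[|c p]] /=; first by move=> _ ba; rewrite ba eqxx in ab.
  by rewrite /adj /= inE.
have [H20|/set0Pn[A AH]] := eqVneq H.2 set0.
  by case/negP: noedge; move: Hcon; rewrite {1}[H]surjective_pairing H20.
case/negP: noedge; have := con A AH; rewrite /delete_edge.
suff -> : H.2 :\ A = set0 by [].
apply/setP => B; rewrite !inE; apply/negP => /andP[/eqP BA BH].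
by apply: BA; rewrite (edgeE _ AH) (edgeE _ BH).
Qed.

(** The edge [xy] is the unique edge leaving [H] and the unique edge leaving [H'],
    so no edge leaves their union, which is then the whole vertex set. *)
Lemma adjacent_balloons_dumbbell H H' x y : balloon e H -> balloon e H' ->
  x \in H.1 -> y \in H'.1 -> H != H' -> e x y -> dumbbell e.
Proof.
move=> Hb H'b xH yH' HH' xy.
have disj := balloons_disjoint Hb H'b HH'.
have xH' : x \notin H'.1 by rewrite (disjointFr disj xH).
have yH : y \notin H.1 by rewrite (disjointFl disj yH').
have cutE : cut e H.1 = [set (x, y)].
  have /eqP/cards1P[p pE] := balloon_cut Hb.
  have : (x, y) \in cut e H.1 by rewrite inE /= xH yH.
  by rewrite pE inE => /eqP ->.
have cutE' : cut e H'.1 = [set (y, x)].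
  have /eqP/cards1P[p pE] := balloon_cut H'b.
  have : (y, x) \in cut e H'.1 by rewrite inE /= xH' yH' e_sym.
  by rewrite pE inE => /eqP ->.
have out a b : a \in H.1 -> e a b -> b \notin H.1 -> (a, b) = (x, y).
  by move=> aH ab bH; apply/set1P; rewrite -cutE inE /= aH bH.
have out' a b : a \in H'.1 -> e a b -> b \notin H'.1 -> (a, b) = (y, x).
  by move=> aH ab bH; apply/set1P; rewrite -cutE' inE /= aH bH.
have all_in z : (z \in H.1) || (z \in H'.1).
  have <- : (z \in H.1 :|: H'.1) = (z \in H.1) || (z \in H'.1) by rewrite inE.
  have := connect_edges x z.
  have xU : x \in H.1 :|: H'.1 by rewrite inE xH.
  move=> /(closed_connect _) <- //.
  apply: intro_closed; first exact/connect_adj_sym.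
  move=> a b; rewrite /adj /= edges_pair => ab; rewrite !inE.
  have [bH|bH] := boolP (b \in H.1); first by [].
  have [bH'|bH'] := boolP (b \in H'.1); first by [].
  case/orP=> aH; first by have [_ bE] := out _ _ aH ab bH; rewrite bE yH' in bH'.
  by have [_ bE] := out' _ _ aH ab bH'; rewrite bE xH in bH.
have Hmax : maximal_two_edge_connected e H by case/andP: Hb.
have H'max : maximal_two_edge_connected e H' by case/andP: H'b.
exists H, H', x, y; split; first split=> //.
  apply/setP => K; rewrite !inE; apply/idP/orP => [Kb|[]/eqP-> //].
  have [//|KH] := eqVneq K H; first by left.
  have [//|KH'] := eqVneq K H'; first by right.
  have /andP[/and3P[_ /and3P[K1 _ _] _] _] := Kb.
  have /card_gt0P[z zK] : (0 < #|K.1|)%N by exact: ltnW.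
  have := all_in z.
  by rewrite (disjointFr (balloons_disjoint Kb Hb KH) zK)
             (disjointFr (balloons_disjoint Kb H'b KH') zK).
congr (_, _); first by apply/setP => z; rewrite !inE all_in.
apply/setP => A; rewrite !in_setU in_set1; apply/idP/idP => [/edgesP[a [b [ab ->]]]|].
  have inH := edge_inside_maximal Hmax; have inH' := edge_inside_maximal H'max.
  have [aH|aH] := boolP (a \in H.1); have [bH|bH] := boolP (b \in H.1).
  - by rewrite inH ?orbT.
  - by have [-> ->] := out _ _ aH ab bH; rewrite eqxx.
  - have [-> ->] : (b, a) = (x, y) by apply: out; rewrite // e_sym.
    by rewrite setUC eqxx.
  - have := all_in a; have := all_in b; rewrite (negPf aH) (negPf bH) /= => bH' aH'.
    by rewrite inH' ?orbT.
case/or3P=> [/eqP->|AH|AH]; first by rewrite edges_pair.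
  by case/and3P: Hmax => /andP[/andP[_ /subsetP sE] _] _ _; exact: sE.
by case/and3P: H'max => /andP[/andP[_ /subsetP sE] _] _ _; exact: sE.
Qed.

End Balloons.

(** * The union of the balloons *)

Section BalloonUnion.
Variables (T : finType) (e : rel T).
Hypothesis e_sym : symmetric e.
Hypothesis e_irr : irreflexive e.
Hypothesis e_conn : connected (whole e).

Definition balloon_union : {set T} := \bigcup_(H in balloons e) H.1.

Lemma card_balloon_union :
  #|balloon_union| = (\sum_(H in balloons e) #|H.1|)%N.
Proof.
pose A (H : graph T) := if H \in balloons e then H.1 else set0.
have disjA H H' : H != H' -> [disjoint A H & A H'].
  rewrite /A; have [Hb|_] := boolP (H \in balloons e); last by rewrite -setI_eq0 set0I.
  have [H'b|_] := boolP (H' \in balloons e); last by rewrite -setI_eq0 setI0.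
  by rewrite !inE in Hb H'b; exact: balloons_disjoint.
rewrite /balloon_union big_mkcond -/(A _) -sum1_card.
rewrite (partition_disjoint_bigcup addn (fun=> 1%N) disjA) [RHS]big_mkcond.
by apply: eq_bigr => H _; rewrite sum1_card /A; case: ifP => // _; rewrite cards0.
Qed.

(** Were the outer end of the edge leaving [H] in another balloon, the graph would
    be a dumbbell. *)
Lemma balloon_exit H : ~ dumbbell e -> balloon e H ->
  exists2 p, p \in cut e balloon_union & p.1 \in H.1.
Proof.
move=> ndumb Hb; have : (0 < #|cut e H.1|)%N by rewrite balloon_cut.
case/card_gt0P => -[x y]; rewrite inE /= => /and3P[xH yH xy].
exists (x, y); rewrite // inE /= xy andbT; apply/andP; split.
  by apply/bigcupP; exists H; rewrite // inE.
apply/bigcupP => -[H']; rewrite inE => H'b yH'; apply: ndumb.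
apply: (adjacent_balloons_dumbbell e_sym e_conn Hb H'b xH yH' _ xy).
by apply: contraNneq yH => ->.
Qed.

(** A balloon is recovered, as a component, from the inner end of its exit edge. *)
Lemma card_balloons_le_cut : ~ dumbbell e ->
  (#|balloons e| <= #|cut e balloon_union|)%N.
Proof.
move=> ndumb.
apply: leq_trans (leq_imset_card (fun p => component_graph e p.1) _).
apply/subset_leq_card/subsetP => H; rewrite inE => Hb.
have [p pcut pH] := balloon_exit ndumb Hb.
apply/imsetP; exists p => //; apply: maximal_is_component => //.
by case/andP: Hb.
Qed.

Lemma balloon_union_proper : ~ dumbbell e -> (0 < #|balloons e|)%N ->
  (#|balloon_union| < #|T|)%N.
Proof.
move=> ndumb /leq_trans/(_ (card_balloons_le_cut ndumb)) /card_gt0P[[x y]].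
rewrite inE /= => /and3P[_ yU _]; rewrite -cardsT; apply: proper_card.
by apply/properP; split; rewrite ?subsetT //; exists y.
Qed.

(** A balloon with the most vertices serves: it is at least of average size, and
    each of the others takes [s] vertices of the union. *)
Lemma large_balloon s : (0 < #|balloons e|)%N ->
    (forall H, balloon e H -> (s <= #|H.1|)%N) ->
  exists2 H, balloon e H &
    (#|balloon_union| <= #|balloons e| * #|H.1|)%N /\
    (#|H.1| + #|balloons e|.-1 * s <= #|balloon_union|)%N.
Proof.
move=> /card_gt0P[H0 H0b] ge_s.
have [H /= Hb Hmax] := @arg_maxnP _ H0 [in balloons e] (fun H => #|H.1|) H0b.
exists H; first by move: Hb; rewrite [in X in X -> _]inE.
rewrite card_balloon_union; split.
  by rewrite -sum_nat_const; exact: leq_sum.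
rewrite (bigD1 H) //= leq_add2l.
have -> : #|balloons e|.-1 = #|balloons e :\ H| by rewrite (cardsD1 H) Hb.
rewrite -sum_nat_const (eq_bigl [pred K | K \in balloons e & K != H]); last first.
  by move=> K; rewrite !inE andbC.
by apply: leq_sum => K /andP[]; rewrite inE => /ge_s.
Qed.

End BalloonUnion.

(** * Counting balloons *)

(** The numerical contradiction: [up] combines the hypothesis on the eigenvalues
    with the bound on [mu2], and against the bound on [mun] it leaves the excess
    [(n - t) * (n - x + t) - n * (n - x) = t * (x - t)], which is positive. *)
Lemma balloon_balance (R : realFieldType) (mu2 mun r n x k b s : R)
    (t := (b - 1) * s) :
    0 < k -> 0 < s -> 1 < b -> x < n -> k + t <= x -> x <= b * k ->
    r * n <= b - 1 -> (1 - r * s) * mun <= mu2 ->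
    mu2 * (k * (n - k)) <= n -> n * b <= mun * (x * (n - x)) ->
  False.
Proof.
move=> k0 s0 b1 xn ktx xbk rn hyp small large.
have t0 : 0 < t by rewrite mulr_gt0 // subr_gt0.
have x0 : 0 < x by lra.
have n0 : 0 < n by lra.
have b0 : 0 < b by lra.
have mun0 : 0 < mun.
  have cross0 : 0 < x * (n - x) by rewrite mulr_gt0 ?subr_gt0.
  rewrite -(pmulr_lgt0 _ cross0).
  by apply: lt_le_trans large; rewrite mulr_gt0.
have nt : (n - t) * mun <= n * mu2.
  apply: (@le_trans _ _ (n * ((1 - r * s) * mun))); last by rewrite ler_pM2l.
  rewrite mulrA ler_pM2r // mulrBr mulr1 lerB // mulrCA.
  by rewrite mulrA ler_pM2r.
have up : (n - t) * mun * (x * (n - x + t)) <= n * (n * b).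
  apply: (@le_trans _ _ ((n - t) * mun * ((b * k) * (n - k)))).
    rewrite ler_pM2l; last by rewrite mulr_gt0 //; lra.
    by apply: ler_pM => //; lra.
  apply: (@le_trans _ _ (n * mu2 * ((b * k) * (n - k)))).
    by rewrite ler_pM2r // !mulr_gt0 //; lra.
  have -> : n * mu2 * (b * k * (n - k)) = n * b * (mu2 * (k * (n - k))) by ring.
  by rewrite [leRHS]mulrA (mulrAC n n) ler_pM2l // mulr_gt0.
have : 0 < mun * x * (t * (x - t)).
  by rewrite !mulr_gt0 //; lra.
have : n * (n * b) <= n * (mun * (x * (n - x))) by rewrite ler_pM2l.
have -> : mun * x * (t * (x - t)) =
  (n - t) * mun * (x * (n - x + t)) - n * (mun * (x * (n - x))) by ring.
by lra.
Qed.

Lemma balloons_le_of_size (R : realType) (T : finType) (e : rel T) (r : R) (s : nat)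
    (n := #|T|) :
    symmetric e -> irreflexive e -> connected (whole e) -> ~ dumbbell e ->
    0 < r -> (0 < s)%N -> (forall H, balloon e H -> (s <= #|H.1|)%N) ->
    (1 - r * s%:R) * eig (laplacian e R) n <= eig (laplacian e R) 2 ->
  #|balloons e|%:Z <= Num.ceil (r * n%:R).
Proof.
move=> e_sym e_irr e_conn ndumb r0 s0 ge_s hyp.
rewrite leNgt; apply/negP; rewrite -lezD1 -lerBrDr ceil_le_int intrB => rn.
have n0 : (0 < n)%N.
  by case/andP: e_conn => /set0Pn[x _] _; apply/card_gt0P; exists x.
have b1 : 1 < #|balloons e|%:R :> R.
  by rewrite -subr_gt0; apply: lt_le_trans rn; rewrite mulr_gt0 // ltr0n.
have b0 : (0 < #|balloons e|)%N by rewrite -(ltr0n R) (lt_trans ltr01).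
have [H Hb [xbk ktx]] := large_balloon e_sym e_conn b0 ge_s.
apply: (@balloon_balance R (eig (laplacian e R) 2) (eig (laplacian e R) n) r n%:R
  #|balloon_union e|%:R #|H.1|%:R #|balloons e|%:R s%:R) => //.
- by rewrite ltr0n (leq_trans s0) ?ge_s.
- by rewrite ltr0n.
- by rewrite ltr_nat; exact: balloon_union_proper.
- by rewrite -[X in _ - X]/(1%:R) -natrB // -natrM -natrD ler_nat subn1.
- by rewrite -natrM ler_nat.
- by have := second_le_cut R e_sym H.1; rewrite balloon_cut // mulr1.
- apply: le_trans (cut_le_max R e_sym _).
  by rewrite ler_pM2l ?ltr0n // ler_nat; exact: card_balloons_le_cut.
Qed.

Theorem theorem3p1 (R : realType) (T : finType) (e : rel T)
  (e_sym : symmetric e) (e_irr : irreflexive e)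
  (e_conn : connected (whole e)) (e_ndumb : ~ dumbbell e) (r : R)
  (r_gt0 : 0 < r)
  (r_le : r <= Num.min (1 / 3%:R) (1 / ((min_deg e)%:R + 1))) :
  let n := #|T| in
  let delta := min_deg e in
  let mu2 := eig (laplacian e R) 2 in
  let mun := eig (laplacian e R) n in
  let b := #|balloons e| in
  ((2 <= delta)%N -> mu2 >= (1 - r - r * delta%:R) * mun ->
     b%:Z <= Num.ceil (r * n%:R)) /\
  (delta = 1%N -> mu2 >= (1 - 3%:R * r) * mun ->
     b%:Z <= Num.ceil (r * n%:R)).
Proof.
move=> n delta mu2 mun b; split=> _ hyp.
  apply: (@balloons_le_of_size _ _ _ _ delta.+1) => //.
    by move=> H; exact: balloon_gt_min_deg.
  by apply: le_trans hyp; rewrite -natr1 mulrDr mulr1 opprD addrCA addrC -/n.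
apply: (@balloons_le_of_size _ _ _ _ 3) => //; last by rewrite (mulrC r).
move=> H /andP[/and3P[HG H2 _] _].
exact: two_edge_connected_gt2 HG H2.
Qed.
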